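(* Let $n\ge 1$ and $m\ge 1$. If $n\le 2m$, then the equation $(-\Delta)^m u=e^u$ in $\mathbb{R}^n$ admits no stable solutions.
   Context: A (classical, not necessarily radial) solution $u\in C^{2m}(\mathbb{R}^n)$ of $(-\Delta)^m u=e^u$ in $\mathbb{R}^n$ is called stable if, for any $\varphi\in C^\infty_c(\mathbb{R}^n)$, $$\int_{\mathbb{R}^n}|\Delta^{m/2}\varphi|^2dx-\int_{\mathbb{R}^n}e^u\varphi^2dx\ge 0\quad\text{if } m\text{ is even},$$ $$\int_{\mathbb{R}^n}|\nabla(\Delta^{\frac{m-1}{2}}\varphi)|^2dx-\int_{\mathbb{R}^n}e^u\varphi^2dx\ge 0\quad\text{if } m\text{ is odd}.$$ *)

(* Defs.v *)
From HB Require Import structures.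
From mathcomp Require Import all_boot all_order all_algebra.
From mathcomp Require Import all_classical all_reals all_analysis.

Set Implicit Arguments.
Unset Strict Implicit.
Unset Printing Implicit Defensive.

Import Order.TTheory GRing.Theory Num.Theory.
Import numFieldNormedType.Exports.

Local Open Scope classical_set_scope.
Local Open Scope ring_scope.

(* R^n is 'rV[R]_n for the topology and the derivatives. Measures live on
   n.-tuple R, which carries the library's product sigma-algebra; [integral_Rn]
   transports integrands along the canonical bijection n.-tuple R -> 'rV[R]_n. *)

Section lebesgue_measure_Rn.
Context {R : realType}.
Local Open Scope ereal_scope.

Definition tuple_cons n (p : measurableTypeR R * n.-tuple (measurableTypeR R)) :
  n.+1.-tuple (measurableTypeR R) := [tuple of p.1 :: p.2].

Lemma measurable_tuple_cons n : measurable_fun setT (@tuple_cons n).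
Proof. exact: measurable_cons. Qed.

Section step.
Variables (n : nat).
Variable mu : {sigma_finite_measure set (n.-tuple (measurableTypeR R)) -> \bar R}.

Definition lebesgue_cons : set (n.+1.-tuple (measurableTypeR R)) -> \bar R :=
  pushforward (@lebesgue_measure R \x mu) (@tuple_cons n).

Let lebesgue_cons0 : lebesgue_cons set0 = 0.
Proof. by rewrite /lebesgue_cons /pushforward preimage_set0 measure0. Qed.

Let lebesgue_cons_ge0 A : 0 <= lebesgue_cons A.
Proof. exact: (measure_ge0 (@lebesgue_measure R \x mu)). Qed.

Let lebesgue_cons_sigma_additive : semi_sigma_additive lebesgue_cons.
Proof.
pose f := @tuple_cons n.
pose mf : measurable_fun setT f := @measurable_tuple_cons n.
move=> F mF tF mUF; rewrite /lebesgue_cons /pushforward preimage_bigcup.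
apply: measure_semi_sigma_additive.
- by move=> k; rewrite -[X in measurable X]setTI; exact: mf.
- apply/trivIsetP => /= i j _ _ ij; rewrite -preimage_setI.
  by move/trivIsetP : tF => /(_ _ _ _ _ ij) ->//; rewrite preimage_set0.
- by rewrite -preimage_bigcup -[X in measurable X]setTI; exact: mf.
Qed.

HB.instance Definition _ := isMeasure.Build _ _ _ lebesgue_cons
  lebesgue_cons0 lebesgue_cons_ge0 lebesgue_cons_sigma_additive.

Let lebesgue_cons_sigma_finite : sigma_finite setT lebesgue_cons.
Proof.
have [F FT mF] : sigma_finite setT (@lebesgue_measure R \x mu).
  have /sigma_finiteP[F [TF ndF Foo]] := sigma_finiteT (@lebesgue_measure R).
  have /sigma_finiteP[G [TG ndG Goo]] := sigma_finiteT mu.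
  exists (fun k => F k `*` G k).
    rewrite -setXTT TF TG predeqE => -[x y]; split.
      move=> [/= [k _ Fkx] [l _ Gly]]; exists (maxn k l) => //; split.
      - by move: x Fkx; exact/subsetPset/ndF/leq_maxl.
      - by move: y Gly; exact/subsetPset/ndG/leq_maxr.
    by move=> [k _ []/= ? ?]; split; exists k.
  move=> k; have [? ?] := Foo k; have [? ?] := Goo k.
  split; first exact: measurableX.
  by rewrite product_measure1E// lte_mul_pinfty// ge0_fin_numE.
pose g (t : n.+1.-tuple (measurableTypeR R)) := (thead t, [tuple of behead t]).
have mg : measurable_fun setT g.
  apply/measurable_fun_pairP; split; first exact: measurable_tnth.
  exact: measurable_behead.
have fK p : g (tuple_cons p) = p.
  by case: p => x t; rewrite /g theadE; congr pair; exact: val_inj.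
exists (fun k => g @^-1` F k).
  by rewrite -preimage_bigcup -FT preimage_setT.
move=> k; have [mFk Fk] := mF k; split.
  by rewrite -[X in measurable X]setTI; exact: mg.
rewrite /lebesgue_cons /pushforward -comp_preimage.
by rewrite (_ : g \o _ = id) ?preimage_id//; apply/funext.
Qed.

HB.instance Definition _ := Measure_isSigmaFinite.Build _ _ _ lebesgue_cons
  lebesgue_cons_sigma_finite.

End step.

Fixpoint lebesgue_measure_Rn n :
    {sigma_finite_measure set (n.-tuple (measurableTypeR R)) -> \bar R} :=
  match n with
  | 0 => \d_([tuple] : 0.-tuple (measurableTypeR R))
  | k.+1 => lebesgue_cons (lebesgue_measure_Rn k)
  end.

(* This characterizes the n-dimensional Lebesgue measure. *)
Lemma lebesgue_measure_Rn_box n (A : 'I_n -> set (measurableTypeR R)) :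
  (forall i, measurable (A i)) ->
  lebesgue_measure_Rn n [set t | forall i, A i (tnth t i)] =
  \prod_(i < n) lebesgue_measure (A i).
Proof.
elim: n A => [|n IH] A mA.
  rewrite big_ord0 /= diracE mem_set//=.
  by case.
rewrite big_ord_recl -IH// /= /lebesgue_cons /pushforward.
rewrite -product_measure1E//=; last first.
  rewrite (_ : [set t | _] =
      \bigcap_(i in [set: 'I_n]) ((@tnth n _ ^~ i) @^-1` A (lift ord0 i))).
    apply: fin_bigcap_measurable => // i _.
    by rewrite -[X in measurable X]setTI; exact: measurable_tnth.
  by apply/seteqP; split => t /= h i; [move=> _|]; exact: h.
congr ((_ \x _) _); apply/seteqP; split => -[x t] /=.
  move=> h; split; first by have := h ord0.
  by move=> i; have := h (lift ord0 i); rewrite /tuple_cons tnthS.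
move=> [h0 h] i; case: (unliftP ord0 i) => [j ->|->//].
by rewrite /tuple_cons tnthS; exact: h.
Qed.

Definition integral_Rn n (f : 'rV[R]_n -> R) : \bar R :=
  \int[lebesgue_measure_Rn n]_t (f (\row_i tnth t i))%:E.

End lebesgue_measure_Rn.

Section differential_operators.
Context {R : realType} {n : nat}.
Implicit Types (f u phi : 'rV[R]_n -> R) (k : nat).

Definition basis_vec (i : 'I_n) : 'rV[R]_n := delta_mx 0 i.

Definition partial (i : 'I_n) f : 'rV[R]_n -> R := fun x => 'D_(basis_vec i) f x.

Fixpoint is_Ck k f : Prop :=
  match k with
  | 0 => continuous f
  | k'.+1 => continuous f /\
      forall i, (forall x, derivable f x (basis_vec i)) /\ is_Ck k' (partial i f)
  end.

Definition support f : set 'rV[R]_n := closure [set x | f x != 0].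

Definition test_function f : Prop :=
  (forall k, is_Ck k f) /\ compact (support f).

Definition laplacian f : 'rV[R]_n -> R :=
  fun x => \sum_(i < n) partial i (partial i f) x.

(* Euclidean norm squared of the gradient; `|_| on 'rV is the sup norm. *)
Definition grad_norm2 f : 'rV[R]_n -> R :=
  fun x => \sum_(i < n) (partial i f x) ^+ 2.

Definition polyharmonic m f : 'rV[R]_n -> R :=
  iter m (fun g x => - laplacian g x) f.

Definition is_solution m f : Prop :=
  is_Ck (2 * m)%N f /\ forall x, polyharmonic m f x = expR (f x).

(* |Delta^{m/2} phi|^2 for m even, |grad Delta^{(m-1)/2} phi|^2 for m odd *)
Definition energy_density m f : 'rV[R]_n -> R :=
  if odd m then grad_norm2 (iter (m.-1)./2 laplacian f)
  else fun x => `|iter m./2 laplacian f x| ^+ 2.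

(* For u continuous both integrands are continuous with compact support, so the
   extended-real difference never involves an infinite term. *)
Definition is_stable m u : Prop :=
  forall phi, test_function phi ->
    (0 <= integral_Rn (energy_density m phi)
          - integral_Rn (fun x => expR (u x) * phi x ^+ 2)%R)%E.

Definition stable_solution m u : Prop := is_solution m u /\ is_stable m u.

End differential_operators.

(* Main.v *)
Require Import Defs.
From mathcomp Require Import all_boot all_order all_algebra.
From mathcomp Require Import all_classical all_reals all_analysis.
From mathcomp Require Import measurable_realfun.
From mathcomp Require Import ring lra.
Set Implicit Arguments.
Unset Strict Implicit.
Unset Printing Implicit Defensive.
Import Order.TTheory GRing.Theory Num.Theory.
Import numFieldNormedType.Exports.
Local Open Scope classical_set_scope.
Local Open Scope ring_scope.

(** In dimension [n <= 2m] the point at infinity has zero capacity for the energy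
    of order [m]: there are test functions [phi_N] that equal a fixed constant
    [v > 0] on the unit ball and whose energy is at most [K / (N + 1)]. Testing
    the stability of [u] with [phi_N] gives

      [v ^ 2 * (integral of e^u over a small cube at 0) <= K / (N + 1)],

    and the left side is a positive number that does not depend on [N].

    The usual way to get [phi_N] in the critical dimension [n = 2m] is a
    logarithmic cutoff. Here it is replaced by an average over scales. Fix a
    radial bump [psi], equal to [v] for [|x| <= 1] and to [0] for [|x| >= 2], and
    let [phi_N] be the mean of [psi (x / 4^j)] for [0 <= j <= N]. The energy
    density is a sum of squares [(D phi)^2] with [D] linear, local, without
    zero-order part and homogeneous of degree [m] ([energy_densityE]). Then
    - [D (psi (. / 4^j))] lives on the annulus [4^j <= |x| <= 2 * 4^j]; these
      annuli are disjoint, so the square of the sum over [j] is the sum of the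
      squares ([scaled_hop_bump_orthogonal], [sqr_sum_orthogonal]);
    - each square is at most [M * 4^(- 2 m j)] on a cube of volume
      [4^n * 4^(n j)], so that each scale contributes at most [M * 4^n] when
      [n <= 2m];
    - the mean brings a factor [1 / (N + 1)^2] in front of [N + 1] such terms.
    This is [energy_multiscale_cutoff]. All the integrals are bounded through
    indicators of cubes only ([integral_Rn_le], [integral_Rn_ge]). *)

(** * Flat functions of one real variable *)

Section flat.
Context {R : realType}.
Implicit Types (p : {poly R}) (t s : R).

(** The classical [exp (- 1 / t)] with a polynomial factor in [1 / t]: with this
    factor the family is stable under differentiation, so one derivative rule
    gives smoothness to all orders. *)
Definition flat p t : R := if 0 < t then p.[t^-1] * expR (- t^-1) else 0.

Lemma flat_le0 p t : t <= 0 -> flat p t = 0.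
Proof. by rewrite /flat leNgt => /negbTE ->. Qed.

Lemma flat1_gt0 t : 0 < t -> 0 < flat 1 t.
Proof. by move=> t0; rewrite /flat t0 hornerC mul1r expR_gt0. Qed.

Lemma flat1_homo t s : t <= s -> flat 1 t <= flat 1 s.
Proof.
move=> ts; case: (lerP t 0) => t0.
  by rewrite flat_le0// /flat; case: ifP => // _; rewrite hornerC mul1r expR_ge0.
have s0 : 0 < s by exact: lt_le_trans ts.
by rewrite /flat t0 s0 !hornerC !mul1r ler_expR lerN2 lef_pV2.
Qed.

Lemma horner_le_expn p s : 1 <= s ->
  `|p.[s]| <= (\sum_(i < size p) `|p`_i|) * s ^+ size p.
Proof.
move=> s1; rewrite horner_coef (le_trans (ler_norm_sum _ _ _))// mulr_suml.
apply: ler_sum => i _; rewrite normrM ler_wpM2l//.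
rewrite ger0_norm ?exprn_ge0 ?(le_trans ler01)//.
by rewrite ler_weXn2l// ltnW.
Qed.

(** The exponential beats every power of [1 / t]. The quadratic rate is what
    makes the difference quotient at [0] tend to [0]. *)
Lemma flat_le_sqr p :
  exists2 C, 0 <= C & forall t, t <= 1 -> `|flat p t| <= C * t ^+ 2.
Proof.
set d := size p; set S := \sum_(i < d) `|p`_i|.
have S0 : 0 <= S by exact: sumr_ge0.
exists (S * d.+2`!%:R); first by rewrite mulr_ge0.
move=> t t1; rewrite /flat; case: ifP => [t0|_]; last first.
  by rewrite normr0 mulr_ge0 ?sqr_ge0// mulr_ge0.
set s := t^-1; have s0 : 0 < s by rewrite invr_gt0.
have s1 : 1 <= s by rewrite invf_ge1.
have es : s ^+ d.+2 / d.+2`!%:R <= expR s.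
  by apply: le_trans (expR_ge1Dxn d.+1 (ltW s0)); rewrite lerDr.
have := horner_le_expn p s1; rewrite -/d -/S => ps.
rewrite normrM (gtr0_norm (expR_gt0 _)) expRN ler_pdivrMr ?expR_gt0//.
apply: (le_trans ps).
have -> : S * s ^+ d = S * d.+2`!%:R * t ^+ 2 * (s ^+ d.+2 / d.+2`!%:R).
  have f0 : d.+2`!%:R != 0 :> R by rewrite pnatr_eq0 -lt0n fact_gt0.
  rewrite !exprS /s; move: f0; set F := d.+2`!%:R => f0; field.
  by rewrite f0 gt_eqF.
by rewrite ler_wpM2l// mulr_ge0 ?sqr_ge0// mulr_ge0.
Qed.

(** With [s = 1 / t], [d/dt (p(s) e^(-s)) = s^2 (p(s) - p'(s)) e^(-s)]. *)
Lemma is_derive_flat p t :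
  is_derive t 1 (flat p) (flat ('X^2 * (p - p^`())) t).
Proof.
case: (ltgtP t 0) => [t0|t0|->].
- rewrite [flat ('X^2 * _) t]flat_le0 ?ltW//.
  apply: (near_eq_is_derive (f := cst 0)).
    by near=> y; rewrite flat_le0//; apply: ltW; near: y; exact: lt_nbhsl.
- rewrite {2}/flat t0.
  apply: (near_eq_is_derive (f := fun t => p.[t^-1] * expR (- t^-1))).
    near=> y; rewrite /flat ifT//; near: y; exact: lt_nbhsr.
  have tn0 : t != 0 by rewrite gt_eqF.
  have dV : is_derive t 1 (fun y : R => y^-1) (- t ^- 2).
    by have := @is_deriveV R id t 1 1 tn0 (is_derive_id _ _);
      rewrite /GRing.scale/= mulr1.
  have dp : is_derive t 1 (fun y : R => p.[y^-1]) (p^`().[t^-1] * (- t ^- 2)).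
    exact: (@is_derive1_comp R (horner p) (fun y => y^-1)).
  have de : is_derive t 1 (fun y : R => expR (- y^-1)) (expR (- t^-1) * (t ^- 2)).
    apply: (@is_derive1_comp R expR (fun y => - y^-1)).
    by have := is_deriveN dV; rewrite opprK.
  apply: (is_derive_eq (is_deriveM dp de)).
  rewrite /GRing.scale /= hornerM hornerXn hornerD hornerN; field.
  by rewrite tn0.
- rewrite [flat ('X^2 * _) 0]flat_le0//.
  have [C C0 Cle] := flat_le_sqr p.
  have H : (fun h : R =>
      h^-1 *: ((flat p \o shift 0) (h *: 1) - flat p 0)) @ 0^' --> 0.
    apply/cvgr0Pnorm_le => e e0; near=> h.
    have h0 : h != 0 by near: h; exact: nbhs_dnbhs_neq.
    rewrite /= [flat p 0]flat_le0// subr0 addr0 /GRing.scale/= mulr1.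
    have h1 : h <= 1.
      by apply: ltW; near: h; apply: nbhs_dnbhs; exact: lt_nbhsl.
    rewrite normrM normfV ler_pdivrMl ?normr_gt0//.
    apply: (le_trans (Cle _ h1)).
    rewrite -(real_normK (num_real h)) expr2 mulrA [leRHS]mulrC ler_wpM2r//.
    have hC : `|h| <= e / (C + 1).
      near: h; apply: nbhs_dnbhs.
      have e1 : 0 < e / (C + 1) by rewrite divr_gt0// ltr_wpDl.
      have := @nbhsx_ballx _ _ (0 : R) _ e1; apply: filterS => y.
      by rewrite /ball/= sub0r normrN => /ltW.
    rewrite (le_trans (ler_wpM2l C0 hC))// mulrCA ler_piMr ?(ltW e0)//.
    by rewrite ler_pdivrMr ?mul1r ?ltr_wpDl// lerDl.
  by apply: DeriveDef; [apply/cvg_ex; exists 0|exact: cvg_lim].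
Unshelve. all: by end_near. Qed.

Lemma continuous_flat p : continuous (flat p).
Proof.
move=> t; apply: differentiable_continuous; apply/derivable1_diffP.
by have [] := is_derive_flat p t.
Qed.

End flat.

(** * Calculus of smooth functions on R^n *)

Section smooth_functions.
Context {R : realType} {n : nat}.
Implicit Types (f g : 'rV[R]_n -> R) (k : nat) (i : 'I_n).

Lemma is_Ck_continuous k f : is_Ck k f -> continuous f.
Proof. by case: k => [|k] // []. Qed.

Lemma is_CkW k f : is_Ck k.+1 f -> is_Ck k f.
Proof.
elim: k f => [|k IH] f; first by case.
by move=> [cf df]; split=> // i; have [dfi /IH] := df i.
Qed.

Lemma is_derive_partial f i x :
  derivable f x (basis_vec i) ->
  is_derive x (basis_vec i) f (partial i f x).
Proof. exact: derivableP. Qed.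

(** Introduction rule for the closure properties below: guess the partial
    derivatives, and smoothness of order [k] is only asked of the guess. *)
Lemma is_CkS k f (df : 'I_n -> 'rV[R]_n -> R) :
  continuous f -> (forall i x, is_derive x (basis_vec i) f (df i x)) ->
  (forall i, is_Ck k (df i)) -> is_Ck k.+1 f.
Proof.
move=> cf dfE dfk; split=> // i; split=> [x|]; first by have [] := dfE i x.
suff -> : partial i f = df i by [].
by apply/funext => x; have [_] := dfE i x.
Qed.

Lemma is_CkD k f g : is_Ck k f -> is_Ck k g -> is_Ck k (fun x => f x + g x).
Proof.
elim: k f g => [|k IH] f g.
  by move=> cf cg x; exact: (cvgD (cf x) (cg x)).
move=> [cf df] [cg dg].
apply: (is_CkS (df := fun i x => partial i f x + partial i g x)).
- by move=> x; exact: (cvgD (cf x) (cg x)).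
- by move=> i x; apply: is_deriveD; apply: is_derive_partial;
    [exact: (df i).1|exact: (dg i).1].
- by move=> i; apply: IH; [exact: (df i).2|exact: (dg i).2].
Qed.

Lemma is_CkM k f g : is_Ck k f -> is_Ck k g -> is_Ck k (fun x => f x * g x).
Proof.
elim: k f g => [|k IH] f g.
  by move=> cf cg x; exact: (cvgM (cf x) (cg x)).
move=> fk gk; have := gk; have := fk; move=> [cf df] [cg dg].
apply: (is_CkS (df := fun i x => f x * partial i g x + g x * partial i f x)).
- by move=> x; exact: (cvgM (cf x) (cg x)).
- by move=> i x; apply: is_deriveM; apply: is_derive_partial;
    [exact: (df i).1|exact: (dg i).1].
- by move=> i; apply: is_CkD; apply: IH;
  [exact: is_CkW|exact: (dg i).2|exact: is_CkW|exact: (df i).2].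
Qed.

Lemma is_Ck_cst k (c : R) : is_Ck k (fun _ : 'rV[R]_n => c).
Proof.
elim: k c => [|k IH] c; first exact: cst_continuous.
apply: (is_CkS (df := fun _ _ => 0)).
- exact: cst_continuous.
- by move=> i; exact: IH.
Qed.

Lemma is_derive_coord (j : 'I_n) (x v : 'rV[R]_n) :
  is_derive x v (fun y : 'rV[R]_n => y 0 j) (v 0 j).
Proof.
apply: (DeriveDef (f := fun y : 'rV[R]_n => y 0 j)); last first.
  rewrite /derive; apply: cvg_lim => //.
  apply: cvg_near_cst; near=> h.
  have h0 : h != 0 by near: h; exact: nbhs_dnbhs_neq.
  by rewrite /= !mxE addrK /GRing.scale/= mulKf.
apply/cvg_ex; exists (v 0 j).
apply: cvg_near_cst; near=> h.
have h0 : h != 0 by near: h; exact: nbhs_dnbhs_neq.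
by rewrite /= !mxE addrK /GRing.scale/= mulKf.
Unshelve. all: by end_near. Qed.

Lemma is_Ck_coord k (j : 'I_n) : is_Ck k (fun y : 'rV[R]_n => y 0 j).
Proof.
case: k => [|k]; first exact: coord_continuous.
apply: (is_CkS (df := fun i _ => basis_vec i 0 j)).
- exact: coord_continuous.
- by move=> i x; exact: is_derive_coord.
- by move=> i; exact: is_Ck_cst.
Qed.

(** A directional derivative is a derivative along a line, which gives access
    to the one-variable chain rule. *)
Lemma is_derive1_line f x v d :
  is_derive x v f d <-> is_derive (0 : R) 1 (fun h : R => f (h *: v + x)) d.
Proof.
have E : 'D_1 (fun h : R => f (h *: v + x)) (0 : R) = 'D_v f x.
  rewrite /derive; set g1 := fun h => h^-1 *: _; set g2 := fun h => h^-1 *: _.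
  suff -> : g1 = g2 by [].
  by rewrite funeqE /g1 /g2 => h /=; rewrite addr0 scale0r add0r [_%:A]mulr1.
split=> -[dx <-]; split; rewrite ?E//.
  exact: (derivable1P f x v).1.
exact: (derivable1P f x v).2.
Qed.

Lemma is_derive_flat_comp p g x v d : is_derive x v g d ->
  is_derive x v (fun y => flat p (g y)) (flat ('X^2 * (p - p^`())) (g x) * d).
Proof.
move=> /is_derive1_line dg; apply/is_derive1_line.
apply: (@is_derive1_comp R (flat p) (fun h => g (h *: v + x))) => //.
by rewrite scale0r add0r; exact: is_derive_flat.
Qed.

(** The induction on [k] must range over all [p], because each derivative
    changes the polynomial. *)
Lemma is_Ck_flat_comp k p g : is_Ck k g -> is_Ck k (fun x => flat p (g x)).
Proof.
have cfl q h : continuous h -> continuous (fun x : 'rV[R]_n => flat q (h x)).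
  by move=> ch x; apply: (@continuous_comp _ _ _ h (flat q));
    [exact: ch|exact: continuous_flat].
elim: k p g => [|k IH] p g; first exact: cfl.
move=> gk; have [cg dg] := gk.
apply: (is_CkS (df := fun i x => flat ('X^2 * (p - p^`())) (g x) * partial i g x)).
- exact: cfl.
- by move=> i x; apply: is_derive_flat_comp; apply: is_derive_partial;
  exact: (dg i).1.
- by move=> i; apply: is_CkM; [apply: IH; exact: is_CkW|exact: (dg i).2].
Qed.

Lemma is_derive_scale f c x v d : is_derive (c *: x) v f d ->
  is_derive x v (fun y => f (c *: y)) (c * d).
Proof.
move=> /is_derive1_line df; apply/is_derive1_line.
rewrite (_ : (fun h => _) =
    (fun h => f (h *: v + c *: x)) \o (fun h => c * h)); last first.
  by apply/funext => h /=; rewrite scalerDr scalerA.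
rewrite mulrC; apply: is_derive1_comp; first by rewrite mulr0.
by have := is_deriveZ c (is_derive_id (0 : R) 1); rewrite /GRing.scale/= mulr1.
Qed.

Lemma is_Ck_scale k f c : is_Ck k f -> is_Ck k (fun x => f (c *: x)).
Proof.
have cs (h : 'rV[R]_n -> R) : continuous h ->
    continuous (fun x : 'rV[R]_n => h (c *: x)).
  move=> ch x.
  apply: (continuous_comp (f := fun y : 'rV[R]_n => c *: y) (g := h));
    [exact: scaler_continuous|exact: ch].
elim: k f => [|k IH] f; first exact: cs.
move=> [cf df].
apply: (is_CkS (df := fun i x => c * partial i f (c *: x))).
- exact: cs.
- by move=> i x; apply: is_derive_scale; apply: is_derive_partial; exact: (df i).1.
- by move=> i; apply: is_CkM; [exact: is_Ck_cst|apply: IH; exact: (df i).2].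
Qed.

Definition smooth f := forall k, is_Ck k f.

Lemma smoothD f g : smooth f -> smooth g -> smooth (fun x => f x + g x).
Proof. by move=> sf sg k; exact: is_CkD. Qed.

Lemma smoothM f g : smooth f -> smooth g -> smooth (fun x => f x * g x).
Proof. by move=> sf sg k; exact: is_CkM. Qed.

Lemma smooth_cst (c : R) : smooth (fun _ : 'rV[R]_n => c).
Proof. by move=> k; exact: is_Ck_cst. Qed.

Lemma smooth_sum (I : Type) (r : seq I) (F : I -> 'rV[R]_n -> R) :
  (forall j, smooth (F j)) -> smooth (fun x => \sum_(j <- r) F j x).
Proof.
move=> sF; elim: r => [|j r IH].
  by rewrite (_ : (fun x => _) = (fun=> 0));
    [exact: smooth_cst|apply/funext=> x; rewrite big_nil].
rewrite (_ : (fun x => _) = (fun x => F j x + \sum_(i <- r) F i x));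
  first exact: smoothD.
by apply/funext=> x; rewrite big_cons.
Qed.

Lemma smooth_scale f c : smooth f -> smooth (fun x => f (c *: x)).
Proof. by move=> sf k; exact: is_Ck_scale. Qed.

Lemma smooth_continuous f : smooth f -> continuous f.
Proof. by move=> /(_ 0%N). Qed.

Lemma smooth_is_derive f i x : smooth f ->
  is_derive x (basis_vec i) f (partial i f x).
Proof. by move=> /(_ 1%N) [_ /(_ i) [df _]]; apply: is_derive_partial. Qed.

Lemma smooth_partial f i : smooth f -> smooth (partial i f).
Proof. by move=> sf k; have [_ /(_ i) []] := sf k.+1. Qed.

End smooth_functions.

(** * Homogeneous differential operators and the energy density *)

Section homogeneous_operators.
Context {R : realType} {n : nat}.
Local Notation fct := ('rV[R]_n -> R).
Implicit Types (f g : fct) (D : fct -> fct) (m : nat).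

(** What the energy argument needs of a constant-coefficient differential
    operator whose terms all have order [m]. In [hop_local] the value
    [c *+ (m == 0)] lets the identity be the operator of order [0], so that
    iterates can be built by composition; for [m > 0] it says that such an
    operator kills locally constant functions. *)
Record homogeneous_op m D : Prop := HomogeneousOp {
  hop_smooth : forall f, smooth f -> smooth (D f);
  hop_linear : forall a f g, smooth f -> smooth g ->
    D (fun x => a * f x + g x) = (fun x => a * D f x + D g x);
  hop_scale : forall c f, smooth f ->
    D (fun x => f (c *: x)) = (fun x => c ^+ m * D f (c *: x));
  hop_local : forall f (c : R) (x : 'rV[R]_n), (\forall y \near x, f y = c) ->
    \forall y \near x, D f y = c *+ (m == 0%N) }.

Lemma hop_id : homogeneous_op 0 id.
Proof.
by split=> // c f _; apply/funext => x; rewrite mul1r.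
Qed.

Lemma hop_partial i : homogeneous_op 1 (partial i).
Proof.
split.
- by move=> f; exact: smooth_partial.
- move=> a f g sf sg; apply/funext => x.
  have df := smooth_is_derive i x sf; have dg := smooth_is_derive i x sg.
  by have [_] := is_deriveD (is_deriveZ a df) dg.
- move=> c f sf; apply/funext => x; rewrite expr1.
  by have [_] := is_derive_scale (smooth_is_derive i (c *: x) sf).
- move=> f c x /nbhs_interior fc; apply: filterS fc => y fc.
  have -> : partial i f y = 'D_(basis_vec i) (cst c) y.
    by apply: near_eq_derive; exact: fc.
  by rewrite derive_cst.
Qed.

Lemma hop0 m D : homogeneous_op m D -> D (fun=> 0) = fun=> 0.
Proof.
move=> h; have := hop_linear h (-1) (smooth_cst 0) (smooth_cst 0).
under eq_fun do rewrite mulN1r addrC subrr.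
by move=> ->; apply/funext => x; rewrite mulN1r addrC subrr.
Qed.

(** Scaling through [D1 \o D2] produces the constant [c ^+ m2] inside [D1];
    linearity with a zero second function takes it out. *)
Lemma hop_comp m1 m2 D1 D2 : homogeneous_op m1 D1 -> homogeneous_op m2 D2 ->
  homogeneous_op (m1 + m2) (D1 \o D2).
Proof.
move=> h1 h2; split.
- by move=> f sf; apply: (hop_smooth h1); apply: (hop_smooth h2).
- move=> a f g sf sg /=; rewrite (hop_linear h2)// (hop_linear h1)//;
    exact: (hop_smooth h2).
- move=> c f sf /=; rewrite (hop_scale h2)//.
  have s2 := hop_smooth h2 sf.
  have s20 := smooth_scale c s2.
  have := hop_linear h1 (c ^+ m2) s20 (smooth_cst 0).
  under eq_fun do rewrite addr0.
  by rewrite (hop0 h1) (hop_scale h1)// => ->; apply/funext => x;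
    rewrite addr0 exprD mulrCA mulrA.
- move=> f c x /(hop_local h2)/(hop_local h1); rewrite addn_eq0.
  by case: (m1 == 0%N); case: (m2 == 0%N).
Qed.

(** The order is positive because the sum of several operators of order [0]
    multiplies a locally constant function by their number. *)
Lemma hop_sum (I : finType) m (D : I -> fct -> fct) :
  (forall i, homogeneous_op m.+1 (D i)) ->
  homogeneous_op m.+1 (fun f x => \sum_i D i f x).
Proof.
move=> h; split.
- by move=> f sf; apply: smooth_sum => i; exact: (hop_smooth (h i)).
- move=> a f g sf sg; apply/funext => x.
  rewrite mulr_sumr -big_split /=; apply: eq_bigr => i _.
  by rewrite (hop_linear (h i)).
- move=> c f sf; apply/funext => x; rewrite mulr_sumr; apply: eq_bigr => i _.
  by rewrite (hop_scale (h i)).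
- move=> f c x fc.
  have : \forall y \near x, forall i, D i f y = 0.
    by apply: (@filter_forall _ _ (fun i y => D i f y = 0) (nbhs x)) => i;
      exact: (hop_local (h i) fc).
  by apply: filterS => y Dy; rewrite big1.
Qed.

Lemma hop_iter m D k : homogeneous_op m D -> homogeneous_op (m * k) (iter k D).
Proof.
move=> h; elim: k => [|k IH]; first by rewrite muln0; exact: hop_id.
by rewrite mulnS; exact: (hop_comp h IH).
Qed.

Lemma hop_laplacian : homogeneous_op 2 (@laplacian R n).
Proof.
apply: (hop_sum (D := fun i => partial i \o partial i)) => i.
exact: hop_comp (hop_partial i) (hop_partial i).
Qed.

(** Both parities at once: one operator [Delta^(m/2)] for [m] even, and the [n]
    operators [d_i Delta^((m-1)/2)] for [m] odd. *)
Lemma energy_densityE m : exists r (D : 'I_r -> fct -> fct),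
  (forall i, homogeneous_op m (D i)) /\
  forall f x, energy_density m f x = \sum_(i < r) (D i f x) ^+ 2.
Proof.
rewrite /energy_density; case: (boolP (odd m)) => om.
  exists n, (fun i => partial i \o iter (m.-1)./2 (@laplacian R n)); split=> // i.
  have em : m = (1 + 2 * (m.-1)./2)%N.
    by case: m om => // m /= om; rewrite add1n mul2n even_halfK.
  by rewrite [m in homogeneous_op m]em;
    exact: hop_comp (hop_partial i) (hop_iter _ hop_laplacian).
exists 1%N, (fun _ => iter m./2 (@laplacian R n)); split=> [_|f x].
  by rewrite -[m in homogeneous_op m]even_halfK// -mul2n;
    exact: (hop_iter _ hop_laplacian).
by rewrite big_ord1 real_normK// num_real.
Qed.

Lemma hop_rescaled_sum m D (N : nat) (c : 'I_N -> R) a f :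
  homogeneous_op m D -> smooth f ->
  D (fun x => a * \sum_(j < N) f (c j *: x)) =
  (fun x => a * \sum_(j < N) c j ^+ m * D f (c j *: x)).
Proof.
move=> h sf.
elim: N c => [|N IH] c.
  under eq_fun do rewrite big_ord0 mulr0.
  by rewrite (hop0 h); apply/funext => x; rewrite big_ord0 mulr0.
under eq_fun do rewrite big_ord_recr /= mulrDr addrC.
rewrite (hop_linear h); first last.
- apply: smoothM; first exact: smooth_cst.
  by apply: smooth_sum => j; exact: smooth_scale.
- exact: smooth_scale.
rewrite IH (hop_scale h)//; apply/funext => x.
by rewrite big_ord_recr /= mulrDr addrC.
Qed.

End homogeneous_operators.

(** * Bounding integrals by cubes *)

Section integral_bounds.
Context {R : realType}.

(** The integral of a nonnegative function is a supremum over the simple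
    functions below it, hence it is monotone on all functions. The
    integrands on ['rV_n] are then bounded without relating its topology to the
    sigma-algebra of tuples. *)
Lemma ge0_le_integral_nonmeasurable d (T : measurableType d)
    (mu : {measure set T -> \bar R}) (f g : T -> \bar R) :
  (forall x, 0 <= f x)%E -> (forall x, f x <= g x)%E ->
  (\int[mu]_x f x <= \int[mu]_x g x)%E.
Proof.
move=> f0 fg; have g0 x : (0 <= g x)%E by exact: le_trans (fg x).
rewrite !ge0_integralTE//; apply: ereal_sup_le => _ [h hf <-].
by exists h => // x; exact: le_trans (fg x).
Qed.

Context {n : nat}.
Local Notation mu := (@lebesgue_measure_Rn R n).

Definition cube (r : R) : set 'rV[R]_n := [set x | forall i, `|x 0 i| <= r].

Let box (r : R) : set (n.-tuple (measurableTypeR R)) :=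
  [set t | forall i, (tnth t i : R) \in `[- r, r]].

Let box_cube r (t : n.-tuple (measurableTypeR R)) :
  \1_(box r) t = \1_(cube r) (\row_i tnth t i) :> R.
Proof.
rewrite !indicE; congr ((nat_of_bool _)%:R); apply/idP/idP; rewrite !inE => H i;
  by have := H i; rewrite mxE in_itv/= ler_norml.
Qed.

Let measurable_box r : measurable (box r).
Proof.
rewrite (_ : box r =
    \bigcap_(i in [set: 'I_n]) ((fun t => tnth t i) @^-1` `[- r, r])).
  apply: fin_bigcap_measurable => // i _.
  by rewrite -[X in measurable X]setTI; exact: measurable_tnth.
by apply/seteqP; split => t /= h i; [move=> _|]; exact: h.
Qed.

Let measure_box r : 0 <= r -> mu (box r) = ((2 * r) ^+ n)%:E.
Proof.
move=> r0.
have -> : box r = [set t | forall i,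
    (`[- r, r]%classic : set (measurableTypeR R)) (tnth t i)].
  by [].
rewrite (@lebesgue_measure_Rn_box R n (fun=> `[- r, r]%classic))//.
under eq_bigr do rewrite lebesgue_measure_itv/=.
have -> : (if (- r)%:E < r%:E then r%:E - (- r)%:E else 0)%E = (2 * r)%:E.
  rewrite lte_fin; case: ifPn => [_|];
    first by rewrite -EFinB opprK mulr_natl mulr2n.
  rewrite -leNgt => rr; have -> : r = 0 by lra.
  by rewrite mulr0.
by rewrite prodEFin prodr_const card_ord.
Qed.

Let measurable_indic_box r :
  measurable_fun [set: n.-tuple (measurableTypeR R)]
    (fun t => (\1_(box r) t)%:E : \bar R).
Proof. by apply/measurable_EFinP; exact: measurable_indic. Qed.

Lemma integral_Rn_le N (f : 'rV[R]_n -> R) (k r : 'I_N -> R) :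
  (forall j, 0 <= k j) -> (forall j, 0 <= r j) -> (forall x, 0 <= f x) ->
  (forall x, f x <= \sum_(j < N) k j * \1_(cube (r j)) x) ->
  (integral_Rn f <= (\sum_(j < N) k j * (2 * r j) ^+ n)%:E)%E.
Proof.
move=> k0 r0 f0 fle; rewrite /integral_Rn.
apply: (@le_trans _ _
  (\int[mu]_t \sum_(j < N) ((k j)%:E * (\1_(box (r j)) t)%:E))%E).
  apply: ge0_le_integral_nonmeasurable => t; first by rewrite lee_fin.
  under eq_bigr do rewrite -EFinM.
  rewrite sumEFin lee_fin (le_trans (fle _))//.
  by apply: ler_sum => j _; rewrite box_cube.
rewrite ge0_integral_sum//; first last.
- by move=> j t _; rewrite mule_ge0// lee_fin.
- by move=> j; exact: (measurable_funeM (k j)%:E (measurable_indic_box (r j))).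
rewrite -sumEFin; apply: lee_sum => j _.
rewrite ge0_integralZl//; last by rewrite lee_fin.
by rewrite integral_indic//= setIT measure_box.
Qed.

Lemma integral_Rn_ge (f : 'rV[R]_n -> R) (k r : R) :
  0 <= k -> 0 <= r -> (forall x, 0 <= f x) ->
  (forall x, cube r x -> k <= f x) ->
  ((k * (2 * r) ^+ n)%:E <= integral_Rn f)%E.
Proof.
move=> k0 r0 f0 fge; rewrite /integral_Rn.
apply: (@le_trans _ _ (\int[mu]_t ((k%:E * (\1_(box r) t)%:E)))%E).
  by rewrite ge0_integralZl// integral_indic//= setIT measure_box.
apply: ge0_le_integral_nonmeasurable => t; first by rewrite mule_ge0// lee_fin.
rewrite box_cube -EFinM lee_fin indicE.
case: (boolP (_ \in _)) => [|_]; last by rewrite mulr0.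
by rewrite inE mulr1 => /fge.
Qed.

End integral_bounds.

(** * The radial bump *)

Section cutoff.
Context {R : realType} {n : nat}.
Implicit Types (x : 'rV[R]_n) (c r : R).

Definition sqnorm x : R := \sum_(i < n) x 0 i ^+ 2.

Lemma smooth_sqnorm : smooth sqnorm.
Proof.
apply: (@smooth_sum R n _ _ (fun i x => x 0 i ^+ 2)) => i.
by apply: smoothM => k; exact: is_Ck_coord.
Qed.

Lemma sqnormZ c x : sqnorm (c *: x) = c ^+ 2 * sqnorm x.
Proof. by rewrite /sqnorm mulr_sumr; apply: eq_bigr => i _; rewrite mxE exprMn. Qed.

Lemma sqnorm_ge0 x : 0 <= sqnorm x.
Proof. by apply: sumr_ge0 => i _; exact: sqr_ge0. Qed.

Lemma sqnorm_cube r x : 0 <= r -> sqnorm x <= r ^+ 2 -> cube r x.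
Proof.
move=> r0 xr i; rewrite -(ler_pXn2r (n := 2))// ?nnegrE//.
rewrite real_normK ?num_real//; apply: le_trans xr.
rewrite /sqnorm (bigD1 i)//= lerDl; apply: sumr_ge0 => j _; exact: sqr_ge0.
Qed.

Lemma compact_cube r : compact (@cube R n r).
Proof.
rewrite (_ : cube r = [set x | forall i, `[- r, r]%classic (x ord0 i)]).
  by apply: (@rV_compact R n (fun=> `[- r, r]%classic)) => i;
    exact: segment_compact.
by apply/seteqP; split => x /= H i; have := H i; rewrite /= in_itv/= ler_norml.
Qed.

(** The inner [flat 1 (|x|^2 - 1)] vanishes for [|x| <= 1] and is at least
    [flat 1 3] once [|x|^2 >= 4]; there the argument of the outer one is
    nonpositive. The plateau value is [flat 1 (flat 1 3)]. *)
Definition bump x : R := flat 1 (flat 1 3 - flat 1 (sqnorm x - 1)).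

Lemma smooth_bump : smooth bump.
Proof.
move=> k; apply: is_Ck_flat_comp.
rewrite (_ : (fun x => _) =
    (fun x => flat 1 3 + (-1) * flat 1 (sqnorm x + - 1))); last first.
  by apply/funext => x; rewrite mulN1r.
apply: is_CkD; first exact: is_Ck_cst.
apply: is_CkM; first exact: is_Ck_cst.
apply: is_Ck_flat_comp; apply: is_CkD; last exact: is_Ck_cst.
exact: smooth_sqnorm.
Qed.

Lemma bump_in x : sqnorm x <= 1 -> bump x = flat 1 (flat 1 3).
Proof. by move=> x1; rewrite /bump (flat_le0 _ (t := _ - 1)) ?subr0// subr_le0. Qed.

Lemma bump_out x : 4 <= sqnorm x -> bump x = 0.
Proof.
by move=> x4; rewrite /bump flat_le0// subr_le0; apply: flat1_homo; lra.
Qed.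

(** An operator of positive order sees the bump only in the closed annulus
    [1 <= |x| <= 2], the bump being constant on both sides of it. *)
Lemma hop_bump_eq0 m D x : homogeneous_op m.+1 D ->
  (sqnorm x < 1) || (4 < sqnorm x) -> D bump x = 0.
Proof.
move=> hD /orP xq.
have [c cE] : exists c : R, \forall y \near x, bump y = c.
  have cs : {for x, continuous sqnorm} by exact: (smooth_continuous smooth_sqnorm).
  case: xq => xq.
    exists (flat 1 (flat 1 3)); near=> y; apply: bump_in; apply: ltW.
    by near: y; apply: (cvgr_lt _ cs).
  exists 0; near=> y; apply: bump_out; apply: ltW.
  by near: y; apply: (cvgr_gt _ cs).
exact: nbhs_singleton (hop_local hD cE).
Unshelve. all: by end_near. Qed.

End cutoff.

(** * Averaging the bump over scales *)

Lemma sqr_sum_orthogonal (R : comPzRingType) N (b : 'I_N -> R) :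
  (forall j k : 'I_N, (j < k)%N -> b j * b k = 0) ->
  (\sum_j b j) ^+ 2 = \sum_j b j ^+ 2.
Proof.
move=> b0; rewrite expr2 mulr_suml; apply: eq_bigr => j _.
rewrite mulr_sumr (bigD1 j)//= big1 ?addr0 ?expr2// => k kj.
by case: (ltngtP j k) (kj) => [/b0//|/b0 h _|/val_inj ->]; rewrite ?eqxx// mulrC.
Qed.

Section multiscale_cutoff.
Context {R : realType} {n : nat}.
Implicit Types (x : 'rV[R]_n) (N m : nat).

(** The ratio [4] between consecutive scales exceeds the ratio [2] of the radii
    of the annulus, so that the rescaled annuli are disjoint. *)
Definition multiscale_cutoff N x : R :=
  N.+1%:R^-1 * \sum_(j < N.+1) bump ((4 ^- j) *: x).

Lemma multiscale_cutoff_in N x : sqnorm x <= 1 ->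
  multiscale_cutoff N x = flat 1 (flat 1 3).
Proof.
move=> x1; rewrite /multiscale_cutoff (eq_bigr (fun=> flat 1 (flat 1 3))).
  by rewrite sumr_const card_ord -[X in _ * X]mulr_natl mulKf// pnatr_eq0.
move=> j _; apply: bump_in; rewrite sqnormZ mulr_ile1 ?sqr_ge0 ?sqnorm_ge0//.
by rewrite exprn_ile1// ?invr_ge0 ?exprn_ge0// invf_le1 ?exprn_gt0//
  exprn_ege1// ler1n.
Qed.

Lemma test_function_multiscale_cutoff N : test_function (multiscale_cutoff N).
Proof.
split=> [k|].
  apply: is_CkM; first exact: is_Ck_cst.
  apply: (@smooth_sum R n _ _ (fun (j : 'I_N.+1) x => bump ((4 ^- j) *: x))) => j.
  by apply: smooth_scale; exact: smooth_bump.
apply: (subclosed_compact (B := cube (2 * 4 ^+ N))).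
- exact: closed_closure.
- exact: compact_cube.
- have cc : closed (@cube R n (2 * 4 ^+ N)).
    by apply: compact_closed; [exact: norm_hausdorff|exact: compact_cube].
  rewrite [X in _ `<=` X](closure_id _).1//; apply: closureS => x /= xN.
  have [j bj] : exists j : 'I_N.+1, bump ((4 ^- j) *: x) != 0.
    apply/existsP; apply: contra_neqT xN => /existsPn b0.
    rewrite /multiscale_cutoff big1 ?mulr0// => j _; apply/eqP.
    by have := b0 j; rewrite negbK.
  have xj : sqnorm ((4 ^- j) *: x) < 4.
    by rewrite ltNge; apply: contra_neqN bj => /bump_out.
  (* All the bumps vanish outside the ball of radius [2 * 4^N]. *)
  apply: sqnorm_cube; first by rewrite mulr_ge0// exprn_ge0.
  move: xj; rewrite sqnormZ exprVn mulrC ltr_pdivrMr ?exprn_gt0// => /ltW xj.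
  apply: (le_trans xj); rewrite exprMn (_ : 2 ^+ 2 = 4) ?ler_wpM2l//;
    last by rewrite expr2; lra.
  by rewrite lerXn2r ?nnegrE ?exprn_ge0// ler_weXn2l ?ler1n// -ltnS.
Qed.

(** If [|x| / 4^k >= 1] and [j < k], then [|x| / 4^j >= 4 > 2], so that [x] is
    outside the annulus of the smaller scale. *)
Lemma scaled_hop_bump_orthogonal m D x (j k : nat) :
  homogeneous_op m.+1 D -> (j < k)%N ->
  D (@bump R n) ((4 ^- j) *: x) * D bump ((4 ^- k) *: x) = 0.
Proof.
move=> hD jk; apply/eqP; rewrite mulf_eq0.
case: (boolP ((sqnorm ((4 ^- k) *: x) < 1))) => [x1|].
  by rewrite [X in _ || (X == _)](hop_bump_eq0 hD) ?x1// eqxx orbT.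
rewrite -leNgt sqnormZ => x1.
rewrite (hop_bump_eq0 hD) ?eqxx// sqnormZ.
apply/orP; right.
have -> : 4 ^- j = 4 ^+ (k - j) * 4 ^- k :> R.
  by rewrite -[in 4 ^- k](subnK (ltnW jk)) exprD invfM mulrA mulfV ?mul1r//
    expf_neq0.
rewrite exprMn -mulrA; apply: (@lt_le_trans _ _ (4 ^+ 2));
  first by rewrite expr2; lra.
rewrite -[leLHS]mulr1; apply: ler_pM => //.
rewrite lerXn2r ?nnegrE ?exprn_ge0//.
by rewrite -[leLHS]expr1 ler_weXn2l ?ler1n// subn_gt0.
Qed.

Lemma hop_bump_bounded m r (D : 'I_r -> ('rV[R]_n -> R) -> 'rV[R]_n -> R) :
  (forall i, homogeneous_op m.+1 (D i)) ->
  exists2 M, 0 <= M & forall y, \sum_(i < r) (D i bump y) ^+ 2 <= M * \1_(cube 2) y.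
Proof.
move=> hD; pose e y := \sum_(i < r) (D i bump y) ^+ 2.
have e0 y : 0 <= e y by apply: sumr_ge0 => i _; exact: sqr_ge0.
have ce : continuous e.
  apply: smooth_continuous;
    apply: (@smooth_sum R n _ _ (fun i y => (D i bump y) ^+ 2)) => i.
  by apply: smoothM; apply: (hop_smooth (hD i)); exact: smooth_bump.
have cube0 : @cube R n 2 !=set0 by exists 0 => i; rewrite mxE normr0.
have [c _ cM] := EVT_max_rV cube0 (@compact_cube R n 2) (continuous_subspaceT ce).
exists (e c) => // y; rewrite indicE.
case: (boolP (y \in cube 2)) => y2; first by rewrite mulr1 cM.
rewrite mulr0 big1// => i _; rewrite (hop_bump_eq0 (hD i)) ?expr0n//.
apply/orP; right; rewrite ltNge; apply: contraNN y2 => y4.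
by rewrite inE; apply: sqnorm_cube => //; rewrite expr2; lra.
Qed.

(** The capacity estimate. The condition [n <= 2 * m.+1] enters through
    [t ^+ n <= t ^+ (2 * m.+1)] for [t = 4 ^+ j >= 1]: the volume of the [j]-th
    cube does not outgrow the decay of the squared derivatives. *)
Lemma energy_multiscale_cutoff m : (n <= 2 * m.+1)%N ->
  exists2 K : R, 0 <= K & forall N,
  (integral_Rn (energy_density m.+1 (multiscale_cutoff N)) <= (K / N.+1%:R)%:E)%E.
Proof.
move=> nm; have [r [D [hD eD]]] := @energy_densityE R n m.+1.
have [M M0 eM] := hop_bump_bounded hD.
exists (M * 4 ^+ n) => [|N]; first by rewrite mulr_ge0// exprn_ge0.
set a : R := N.+1%:R^-1.
have a0 : 0 <= a by rewrite invr_ge0.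
pose c (j : 'I_N.+1) : R := 4 ^- j.
have c0 j : 0 <= c j by rewrite invr_ge0 exprn_ge0.
(* Orthogonality of the scales removes the cross terms of each square. *)
have edE x : energy_density m.+1 (multiscale_cutoff N) x =
    \sum_(j < N.+1) a ^+ 2 * c j ^+ (2 * m.+1) *
      \sum_(i < r) D i bump (c j *: x) ^+ 2.
  rewrite eD.
  under [RHS]eq_bigr do rewrite mulr_sumr.
  rewrite exchange_big /=; apply: eq_bigr => i _.
  rewrite (hop_rescaled_sum c a (hD i) smooth_bump) exprMn sqr_sum_orthogonal.
    by rewrite mulr_sumr; apply: eq_bigr => j _; rewrite exprMn -exprM mulnC mulrA.
  move=> j k jk; rewrite mulrACA (scaled_hop_bump_orthogonal x (hD i) jk).
  by rewrite mulr0.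
pose k (j : 'I_N.+1) : R := a ^+ 2 * c j ^+ (2 * m.+1) * M.
pose rad (j : 'I_N.+1) : R := 2 * 4 ^+ j.
have k0 j : 0 <= k j by rewrite !mulr_ge0// ?sqr_ge0 ?exprn_ge0.
have rad0 j : 0 <= rad j by rewrite mulr_ge0// exprn_ge0.
apply: (le_trans (integral_Rn_le (k := k) (r := rad) k0 rad0 _ _)).
- by move=> x; rewrite eD; apply: sumr_ge0 => i _; exact: sqr_ge0.
- move=> x; rewrite edE; apply: ler_sum => j _.
  rewrite /k -(mulrA _ M) ler_wpM2l ?mulr_ge0 ?sqr_ge0 ?exprn_ge0//.
  apply: (le_trans (eM _)); rewrite ler_wpM2l// !indicE.
  case: (boolP (_ *: x \in _)) => [|_]; last by rewrite ler0n.
  rewrite inE => x2; rewrite mem_set ?lexx// => i.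
  have := x2 i; rewrite mxE normrM ger0_norm// /c /rad.
  by rewrite ler_pdivrMl ?exprn_gt0// mulrC.
- rewrite lee_fin.
  apply: (@le_trans _ _ (\sum_(j < N.+1) a ^+ 2 * M * 4 ^+ n)).
    apply: ler_sum => j _; rewrite /k /rad /c; set t : R := 4 ^+ j.
    have t1 : 1 <= t by rewrite exprn_ege1// ler1n.
    have t0 : 0 < t by exact: lt_le_trans t1.
    have -> : 2 * (2 * t) = 4 * t by ring.
    rewrite exprMn (exprVn t).
    have -> : a ^+ 2 / t ^+ (2 * m.+1) * M * (4 ^+ n * t ^+ n) =
      a ^+ 2 * M * 4 ^+ n * (t ^+ n / t ^+ (2 * m.+1)) by ring.
    rewrite ler_piMr ?mulr_ge0 ?sqr_ge0 ?exprn_ge0//.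
    by rewrite ler_pdivrMr ?exprn_gt0// mul1r ler_weXn2l.
  rewrite sumr_const card_ord -[leLHS]mulr_natl /a.
  rewrite le_eqVlt; apply/orP; left; apply/eqP; field.
  by rewrite -[1]/(1%:R) -natrD pnatr_eq0.
Qed.

End multiscale_cutoff.

(** * Nonexistence *)

Theorem theorem3p1 (R : realType) (n m : nat) (hn : (1 <= n)%N) (hm : (1 <= m)%N)
    (hnm : (n <= 2 * m)%N) :
  ~ exists u : 'rV[R]_n -> R, stable_solution m u.
Proof.
move=> [u [[uC _] ust]]; case: m hm hnm uC ust => // m _ nm uC ust.
have [K K0 energyK] := @energy_multiscale_cutoff R n m nm.
have cu : {for 0, continuous u} by exact: (is_Ck_continuous uC).
have cs : {for 0, continuous (@sqnorm R n)}.
  exact: (smooth_continuous smooth_sqnorm).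
(* A cube at the origin inside the plateau, on which [e^u] is bounded below. *)
have [d d0 dP] : exists2 d, 0 < d &
    forall x, cube d x -> u 0 - 1 <= u x /\ sqnorm x <= 1.
  have : \forall x \near (0 : 'rV[R]_n), u 0 - 1 <= u x /\ sqnorm x <= 1.
    near=> x; split; apply: ltW; near: x.
      by apply: (cvgr_gt _ cu); rewrite gtrBl.
    apply: (cvgr_lt _ cs); rewrite /sqnorm big1// => i _.
    by rewrite mxE expr0n.
  move=> /nbhs_ballP[e /= e0 eP]; exists (e / 2); first by rewrite divr_gt0.
  move=> x xe; apply: eP; split=> // i j.
  rewrite mxE /ball/= sub0r normrN ord1.
  by apply: (le_lt_trans (xe j)); rewrite ltr_pdivrMr// ltr_pMr// ltr1n.
set v : R := flat 1 (flat 1 3).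
have v0 : 0 < v by rewrite !flat1_gt0.
pose kappa := expR (u 0 - 1) * v ^+ 2 * (2 * d) ^+ n.
have kappa0 : 0 < kappa by rewrite !mulr_gt0 ?expR_gt0 ?exprn_gt0 ?mulr_gt0.
pose N := Num.bound (K / kappa).
have KN : K / N.+1%:R < kappa.
  rewrite ltr_pdivrMr// mulrC -ltr_pdivrMr//.
  apply: (lt_le_trans (archi_boundP _)); first by rewrite divr_ge0// ltW.
  by rewrite ler_nat.
have potN : (kappa%:E <=
    integral_Rn (fun x => expR (u x) * multiscale_cutoff N x ^+ 2)%R)%E.
  apply: integral_Rn_ge.
  - by rewrite mulr_ge0 ?expR_ge0 ?sqr_ge0.
  - exact: ltW.
  - by move=> x; rewrite mulr_ge0 ?expR_ge0 ?sqr_ge0.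
  move=> x /dP[ux x1]; rewrite multiscale_cutoff_in//.
  by rewrite ler_wpM2r ?sqr_ge0// ler_expR.
have := ust _ (test_function_multiscale_cutoff N).
apply/negP; rewrite -ltNge.
have := leeB (energyK N) potN.
move=> /le_lt_trans; apply.
by rewrite -EFinB lte_fin subr_lt0.
Unshelve. all: by end_near. Qed.
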